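(* Suppose that $0<\theta<1$. For any unital $*$-endomorphism $\varphi$ of $A_{\theta}$, one has $\mathcal{L}(\varphi)\ge 4(3-\sqrt{5})\pi^2$.
   Context: For $\theta\in\mathbb{R}$, $A_\theta$ denotes the rotation $C^*$-algebra, i.e. the universal unital $C^*$-algebra generated by two unitaries $U$ and $V$ subject to $UV=e^{2\pi i\theta}VU$. Let $\mathrm{tr}$ be the canonical faithful tracial state on $A_\theta$, determined by $\mathrm{tr}(U^mV^n)=\delta_{m,0}\delta_{n,0}$ (Kronecker deltas) for all $m,n\in\mathbb{Z}$. Let $\delta_1$ and $\delta_2$ be the canonical unbounded closed $*$-derivations of $A_\theta$, defined on dense $*$-subalgebras of $A_\theta$ and determined by $\delta_1(U)=2\pi i U$, $\delta_1(V)=0$, $\delta_2(U)=0$, $\delta_2(V)=2\pi i V$ (that is, the closures of the derivations given by these formulas on the $*$-algebra generated by $U$ and $V$). The energy of a unitary $u\in A_\theta$ is $$E(u)=\tfrac12\,\mathrm{tr}\big(\delta_1(u)^*\delta_1(u)+\delta_2(u)^*\delta_2(u)\big)$$ if $u$ belongs to the domains of both $\delta_1$ and $\delta_2$, and $E(u)=\infty$ otherwise. The energy of a unital $*$-endomorphism $\varphi$ of $A_\theta$ is $\mathcal{L}(\varphi)=2E(\varphi(U))+2E(\varphi(V))\in[0,\infty]$. *)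

(* Defs.v *)
From HB Require Import structures.
From mathcomp Require Import all_boot all_order all_algebra.
From mathcomp Require Import complex.
From mathcomp Require Import all_classical all_reals all_analysis.

Set Implicit Arguments.
Unset Strict Implicit.
Unset Printing Implicit Defensive.

Import Order.TTheory GRing.Theory Num.Theory.
Import numFieldNormedType.Exports.

Local Open Scope classical_set_scope.
Local Open Scope complex_scope.
Local Open Scope ring_scope.

(* Unital C*-algebras over the complex numbers R[i]. The norm takes its
   (nonnegative real) values in R[i]. MathComp algebras satisfy 1 != 0, so the
   zero algebra is left out; it is the target of exactly one map from any
   algebra, so its omission from universal properties is immaterial. The
   operations are fields of a record over a complete normed module because
   Hierarchy Builder has no structure joining rings with normed modules; the
   carrier cstar_sort A receives both structures as instances. *)
Record cstarAlgType (R : realType) : Type := CStarAlgebra {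
  cstar_space : completeNormedModType R[i];
  cstar_one : cstar_space;
  cstar_mul : cstar_space -> cstar_space -> cstar_space;
  cstar_adj : cstar_space -> cstar_space;
  cstar_mulA : associative cstar_mul;
  cstar_mul1r : left_id cstar_one cstar_mul;
  cstar_mulr1 : right_id cstar_one cstar_mul;
  cstar_mulDl : left_distributive cstar_mul +%R;
  cstar_mulDr : right_distributive cstar_mul +%R;
  cstar_scaleAl : forall (a : R[i]) x y,
    a *: cstar_mul x y = cstar_mul (a *: x) y;
  cstar_scaleAr : forall (a : R[i]) x y,
    a *: cstar_mul x y = cstar_mul x (a *: y);
  cstar_oner_neq0 : cstar_one != 0;
  cstar_adjD : {morph cstar_adj : x y / x + y};
  cstar_adjZ : forall (a : R[i]) x, cstar_adj (a *: x) = a^* *: cstar_adj x;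
  cstar_adjM : forall x y,
    cstar_adj (cstar_mul x y) = cstar_mul (cstar_adj y) (cstar_adj x);
  cstar_adjK : involutive cstar_adj;
  cstar_normM_le : forall x y, `|cstar_mul x y| <= `|x| * `|y|;
  cstar_identity : forall x, `|cstar_mul (cstar_adj x) x| = `|x| ^+ 2
}.

Definition cstar_sort (R : realType) (A : cstarAlgType R) : Type :=
  cstar_space A.
Coercion cstar_sort : cstarAlgType >-> Sortclass.

Section CStarInstances.
Context (R : realType) (A : cstarAlgType R).

HB.instance Definition _ :=
  CompleteNormedModule.copy (cstar_sort A) (cstar_space A).
HB.instance Definition _ := GRing.Zmodule_isNzRing.Build (cstar_sort A)
  (@cstar_mulA R A) (@cstar_mul1r R A) (@cstar_mulr1 R A)
  (@cstar_mulDl R A) (@cstar_mulDr R A) (@cstar_oner_neq0 R A).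
HB.instance Definition _ :=
  GRing.Lmodule_isLalgebra.Build R[i] (cstar_sort A) (@cstar_scaleAl R A).
HB.instance Definition _ :=
  GRing.Lalgebra_isAlgebra.Build R[i] (cstar_sort A) (@cstar_scaleAr R A).

Definition star (x : A) : A := @cstar_adj R A x.

End CStarInstances.

Section CStar.
Context {R : realType}.
Implicit Types A B : cstarAlgType R.

Definition is_unitary A (u : A) := star u * u = 1 /\ u * star u = 1.

(* Used for unitary u only, whose inverse is star u; Negz n stands for -(n+1). *)
Definition zpow A (u : A) (m : int) : A :=
  match m with
  | Posz n => u ^+ n
  | Negz n => star u ^+ n.+1
  end.

(* MathComp's {lrmorphism A -> B} are the unital C-linear ring morphisms. *)
Definition star_preserving A B (f : A -> B) :=
  forall x, f (star x) = star (f x).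

Record star_subalgebra A (D : set A) : Prop := StarSubalgebra {
  star_subalgebra1 : D 1;
  star_subalgebraD : forall x y, D x -> D y -> D (x + y);
  star_subalgebraZ : forall (a : R[i]) x, D x -> D (a *: x);
  star_subalgebraM : forall x y, D x -> D y -> D (x * y);
  star_subalgebra_star : forall x, D x -> D (star x)
}.

Definition star_generated A (S : set A) : set A :=
  smallest (@star_subalgebra A) S.

Definition expi (x : R) : R[i] := cos x +i* sin x.

Definition rotation_relation (theta : R) A (u v : A) :=
  [/\ is_unitary u, is_unitary v
    & u * v = expi (2 * pi * theta) *: (v * u)].

(* A_theta, given with its generators, as the universal unital C*-algebra on
   two unitaries subject to the rotation relation. *)
Definition is_rotation_algebra (theta : R) A (U V : A) :=
  rotation_relation theta U V /\
  forall B (u v : B), rotation_relation theta u v ->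
    (exists f : {lrmorphism A -> B}, [/\ star_preserving f, f U = u & f V = v])
    /\ (forall f g : {lrmorphism A -> B},
          star_preserving f -> f U = u -> f V = v ->
          star_preserving g -> g U = u -> g V = v -> f =1 g).

(* The order of R[i] is such that 0 <= z means that z is real and nonnegative. *)
Record is_faithful_tracial_state A (tr : {linear A -> R[i]^o}) : Prop :=
  IsFaithfulTracialState {
  state_ge0 : forall x, 0 <= (tr (star x * x) : R[i]);
  state1 : tr 1 = 1;
  trace_comm : forall x y, tr (x * y) = tr (y * x);
  trace_faithful : forall x, tr (star x * x) = 0 -> x = 0
}.

Definition is_canonical_trace A (U V : A) (tr : {linear A -> R[i]^o}) :=
  is_faithful_tracial_state tr /\
  forall m n : int, tr (zpow U m * zpow V n) = ((m == 0) && (n == 0))%:R.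

(* The values of op outside of dom are irrelevant. *)
Record unbounded_op A := UnboundedOp {
  dom : set A;
  op :> A -> A
}.

Definition graph A (d : unbounded_op A) : set (A * A) :=
  [set z | dom d z.1 /\ z.2 = d z.1].

Definition restrict_op A (d : unbounded_op A) (D : set A) : unbounded_op A :=
  UnboundedOp (dom d `&` D) d.

Record is_star_derivation A (d : unbounded_op A) : Prop := IsStarDerivation {
  derivation_dom : star_subalgebra (dom d);
  derivation_dense : dense (dom d);
  derivationD : forall x y, dom d x -> dom d y -> d (x + y) = d x + d y;
  derivationZ : forall (a : R[i]) x, dom d x -> d (a *: x) = a *: d x;
  derivationM : forall x y, dom d x -> dom d y -> d (x * y) = d x * y + x * d y;
  derivation_star : forall x, dom d x -> d (star x) = star (d x)
}.

(* d is the closure of the *-derivation of the *-algebra generated by U and V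
   with values dU at U and dV at V. *)
Definition is_canonical_derivation A (U V dU dV : A) (d : unbounded_op A) :=
  [/\ is_star_derivation d,
      dom d U /\ dom d V,
      d U = dU /\ d V = dV
    & graph d = closure (graph (restrict_op d (star_generated [set U; V])))].

Definition twopii : R[i] := 0 +i* (2 * pi).

Definition is_delta1 A (U V : A) := is_canonical_derivation U V (twopii *: U) 0.
Definition is_delta2 A (U V : A) := is_canonical_derivation U V 0 (twopii *: V).

(* The argument of Re is a nonnegative real for a positive functional tr. *)
Definition energy A (tr : {linear A -> R[i]^o}) (d1 d2 : unbounded_op A)
    (u : A) : \bar R :=
  if `[< dom d1 u /\ dom d2 u >] then
    (2^-1 * complex.Re (tr (star (d1 u) * d1 u + star (d2 u) * d2 u)))%:E
  else +oo%E.

Definition endo_energy A (tr : {linear A -> R[i]^o}) (d1 d2 : unbounded_op A)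
    (U V : A) (phi : A -> A) : \bar R :=
  (2%:E * energy tr d1 d2 (phi U) + 2%:E * energy tr d1 d2 (phi V))%E.

End CStar.

(* Main.v *)
Require Import Defs.
From mathcomp Require Import all_boot all_order all_algebra.
From mathcomp Require Import complex.
From mathcomp Require Import all_classical all_reals all_analysis.
From mathcomp Require Import lra.

Import Order.TTheory GRing.Theory Num.Theory.
Import numFieldNormedType.Exports.

Set Implicit Arguments.
Unset Strict Implicit.
Unset Printing Implicit Defensive.

Local Open Scope ring_scope.

(** The energy is controlled by a Poincare inequality on the noncommutative
    torus.  The monomials W_(m,n) = U^m V^n are orthonormal for the inner
    product <x, y> = tr (x^* y), and they are joint eigenvectors of the two
    derivations, with eigenvalues 2 pi i m and 2 pi i n.  So if x lies in both
    domains and a_(m,n) = <W_(m,n), x> are its Fourier coefficients, then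

      tr (delta1(x)^* delta1(x) + delta2(x)^* delta2(x))
        = 4 pi^2 sum_(m,n) (m^2 + n^2) |a_(m,n)|^2,

    and as soon as tr x = a_(0,0) vanishes this is at least
    4 pi^2 sum |a_(m,n)|^2 = 4 pi^2 tr (x^* x) (lemma [poincare]).

    The images u = phi U and v = phi V satisfy u v = lambda v u, where
    lambda = exp (2 pi i theta) differs from 1 because 0 < theta < 1.  Taking
    traces of u = lambda v u v^* gives tr u = lambda tr u, hence tr u = 0, and
    likewise tr v = 0 ([tr_qcommute_eq0]).  Each of the two unitaries therefore
    has energy at least 2 pi^2 ([energy_ge]), and the energy of phi is at least
    8 pi^2, which exceeds 4 (3 - sqrt 5) pi^2 since sqrt 5 >= 1.

    Two analytic points need care.  First, the derivations are closures, so
    their elements are only limits of trigonometric polynomials, and the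
    Fourier coefficients have to be continuous for the norm of the algebra.
    This is the automatic continuity of positive functionals,
    tr (x^* x) <= C |x|^2 ([norm2_le]), which rests on square roots of the
    elements 1 - h with h self-adjoint and small ([exists_sqrt_one_sub]).
    Secondly, infinite sums are avoided: Bessel's inequality for finite sets of
    frequencies bounds the energy below, and a finite set chosen from an
    approximating trigonometric polynomial captures tr (x^* x) up to epsilon
    ([bessel], [parseval_approx]). *)

(** * Norm estimates and square roots in a C*-algebra *)

Section CStarBasics.
Local Open Scope classical_set_scope.
Local Open Scope ring_scope.
Context {R : realType} {A : cstarAlgType R}.
Implicit Types (x y h : A).

Lemma starD x y : star (x + y) = star x + star y.
Proof. exact: (@cstar_adjD R A). Qed.

Lemma starZ (a : R[i]) x : star (a *: x) = a^* *: star x.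
Proof. apply: cstar_adjZ. Qed.

Lemma starM x y : star (x * y) = star y * star x.
Proof. exact: (@cstar_adjM R A). Qed.

Lemma starK : involutive (@star R A).
Proof. exact: (@cstar_adjK R A). Qed.

Lemma star0 : star (0 : A) = 0.
Proof. by rewrite -[X in star X](scale0r (0 : A)) starZ conjC0 scale0r. Qed.

Lemma starN x : star (- x) = - star x.
Proof. by rewrite -scaleN1r starZ rmorphN rmorph1 scaleN1r. Qed.

Lemma starB x y : star (x - y) = star x - star y.
Proof. by rewrite starD starN. Qed.

Lemma star1 : star (1 : A) = 1.
Proof. by rewrite -[LHS]mul1r -{1}(starK 1) -starM mul1r starK. Qed.

(** The norm of the algebra takes values in [R[i]]; as a real number it is
    within reach of the decision procedures for ordered fields. *)
Definition rnorm x : R := complex.Re `|x|.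

Lemma rnormE x : `|x| = (rnorm x)%:C%C.
Proof. by rewrite RRe_real// normr_real. Qed.

Lemma rnorm_ge0 x : 0 <= rnorm x.
Proof. by rewrite -ler0c -rnormE. Qed.

Lemma rnorm0 : rnorm 0 = 0.
Proof. by rewrite /rnorm normr0. Qed.

Lemma rnorm_eq0 x : rnorm x = 0 -> x = 0.
Proof. by move=> x0; apply: normr0_eq0; rewrite rnormE x0. Qed.

Lemma rnormD x y : rnorm (x + y) <= rnorm x + rnorm y.
Proof. by have := ler_normD x y; rewrite !rnormE -rmorphD lecR. Qed.

Lemma rnormN x : rnorm (- x) = rnorm x.
Proof. by rewrite /rnorm normrN. Qed.

Lemma rdistC x y : rnorm (x - y) = rnorm (y - x).
Proof. by rewrite -rnormN opprB. Qed.

Lemma rnormZ (a : R) x : 0 <= a -> rnorm (a%:C%C *: x) = a * rnorm x.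
Proof.
move=> a_ge0; apply: complexI; rewrite rmorphM -rnormE.
have a_ge0' : (0 : R[i]) <= a%:C%C by rewrite ler0c.
rewrite (normrZ (a%:C%C) x); congr (_ * _); last exact: rnormE.
exact: (ger0_norm a_ge0').
Qed.

Lemma rnormM x y : rnorm (x * y) <= rnorm x * rnorm y.
Proof.
by have := @cstar_normM_le R A x y; rewrite !rnormE -rmorphM lecR.
Qed.

Lemma rnorm_starM x : rnorm (star x * x) = rnorm x ^+ 2.
Proof.
by have := @cstar_identity R A x; rewrite !rnormE -rmorphXn; exact: complexI.
Qed.

Lemma rnorm_star x : rnorm (star x) = rnorm x.
Proof.
suff le_star y : rnorm y <= rnorm (star y).
  by apply/eqP; rewrite eq_le le_star -{2}(starK x) le_star.
have := rnorm_ge0 y; rewrite le_eqVlt => /predU1P[<-|y_gt0].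
  exact: rnorm_ge0.
by rewrite -(ler_pM2r y_gt0) -expr2 -rnorm_starM rnormM.
Qed.

Lemma rnorm_complete (s : nat -> A) :
  (forall e : R, 0 < e ->
     exists N, forall n, (N <= n)%N -> rnorm (s n - s N) < e) ->
  exists y, forall e : R, 0 < e ->
    exists N, forall n, (N <= n)%N -> rnorm (y - s n) < e.
Proof.
move=> s_cauchy.
have ReK (e : R[i]) : 0 < e -> exists2 r : R, 0 < r & e = r%:C%C.
  move=> e_gt0; exists (complex.Re e); last by rewrite RRe_real// gtr0_real.
  by rewrite -ltcR RRe_real// gtr0_real.
have s_cvg : cvg (s @ \oo).
  apply/cauchy_cvgP/cauchy_exP => e /ReK[r r_gt0 ->].
  have [N sN] := s_cauchy r r_gt0.
  exists (s N); exists N => // n /= le_Nn; rewrite -ball_normE /=.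
  by rewrite rnormE ltcR rdistC sN.
exists (lim (s @ \oo)) => r r_gt0.
move: s_cvg => /cvgrPdist_lt /(_ r%:C%C); rewrite ltcR => /(_ r_gt0)[N _ sN].
by exists N => n /sN /=; rewrite rnormE ltcR.
Qed.

Lemma closure_prod_approx (S : set (A * A)) (z : A * A) (e : R) : 0 < e ->
  closure S z ->
  exists w, [/\ S w, rnorm (z.1 - w.1) < e & rnorm (z.2 - w.2) < e].
Proof.
move=> e_gt0 clz.
have e_gt0' : 0 < e%:C%C by rewrite ltcR.
have [|w [Sw []]] := clz (ball z.1 e%:C%C `*` ball z.2 e%:C%C).
  by exists (ball z.1 e%:C%C, ball z.2 e%:C%C) => //; split; exact: nbhsx_ballx.
rewrite -!ball_normE /= !rnormE !ltcR => lt1 lt2.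
by exists w.
Qed.

(** If (1 - y)^2 = 1 - h then y = (h + y^2) / 2.  For a self-adjoint h of norm
    at most 1/2, the right-hand side maps the ball of radius 1/2 into itself and
    contracts distances there by 1/2, so its iterates from 0 converge to such a
    y, which is self-adjoint because all the iterates are. *)
Section SquareRoot.
Variable h : A.
Hypotheses (h_self : star h = h) (h_le : rnorm h <= 2^-1).

Let f y := (2^-1)%:C%C *: (h + y * y).
Let s n := iter n f 0.

Let half_ge0 : (0 : R) <= 2^-1. Proof. by rewrite invr_ge0. Qed.

Lemma sqrt_step_bounded y : rnorm y <= 2^-1 -> rnorm (f y) <= 2^-1.
Proof.
move=> y_le; rewrite rnormZ//.
have := ler_pM (rnorm_ge0 y) (rnorm_ge0 y) y_le y_le.
have := rnormD h (y * y); have := rnormM y y; have := h_le; lra.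
Qed.

Lemma sqrt_step_contracts y z : rnorm y <= 2^-1 -> rnorm z <= 2^-1 ->
  rnorm (f y - f z) <= 2^-1 * rnorm (y - z).
Proof.
move=> y_le z_le; rewrite -scalerBr rnormZ//.
have -> : h + y * y - (h + z * z) = y * (y - z) + (y - z) * z.
  by rewrite mulrBr mulrBl opprD addrACA subrr add0r addrA subrK.
have := rnormD (y * (y - z)) ((y - z) * z).
have := ler_wpM2r (rnorm_ge0 (y - z)) y_le.
have := ler_wpM2l (rnorm_ge0 (y - z)) z_le.
have := rnormM y (y - z); have := rnormM (y - z) z; lra.
Qed.

Let s_le n : rnorm (s n) <= 2^-1.
Proof. by elim: n => [|n ih]; rewrite ?rnorm0//=; exact: sqrt_step_bounded. Qed.

Let s_self n : star (s n) = s n.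
Proof.
elim: n => [|n ih]; first exact: star0.
rewrite /= /f starZ starD starM h_self -/(s n) ih.
by congr (_ *: _); apply: conj_Creal; apply/complex_realP; exists 2^-1.
Qed.

Let s_dist n k : rnorm (s (k + n) - s n) <= 2^-1 ^+ n.
Proof.
elim: n => [|n ih].
  by rewrite expr0 subr0 (le_trans (s_le _))//; lra.
rewrite addnS exprS (le_trans (sqrt_step_contracts _ _)) ?s_le//.
by rewrite ler_wpM2l.
Qed.

(** Since y is self-adjoint, y * y = star y * y: the element 1 - h is positive
    in the sense used by states. *)
Lemma exists_sqrt_one_sub : exists2 y, star y = y & 1 - h = y * y.
Proof.
have [e e_gt0|y y_lim] := @rnorm_complete s.
  have : (2^-1 : R^o) ^+ n @[n --> \oo] --> (0 : R^o).
    by apply: cvg_expr; rewrite ger0_norm// invf_lt1// ltr1n.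
  move=> /cvgrPdist_lt /(_ _ e_gt0) [N _ /(_ N (leqnn N))] /=.
  rewrite sub0r normrN ger0_norm ?exprn_ge0// => lt_e.
  by exists N => n le_Nn; rewrite -(subnK le_Nn) (le_lt_trans (s_dist _ _)).
have small x : (forall e : R, 0 < e -> rnorm x <= e) -> x = 0.
  move=> x_small; apply: rnorm_eq0; apply/eqP; rewrite eq_le rnorm_ge0 andbT.
  by apply/ler_addgt0Pr => e e_gt0; rewrite add0r x_small.
have y_le : rnorm y <= 2^-1.
  apply/ler_addgt0Pr => e e_gt0.
  have [N /(_ N (leqnn N)) lt_e] := y_lim e e_gt0.
  have := rnormD (y - s N) (s N); rewrite subrK; have := s_le N; lra.
have fix_y : y - f y = 0.
  apply: small => e e_gt0; have [|N yN] := y_lim (2^-1 * e); first lra.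
  have := rnormD (y - s N.+1) (s N.+1 - f y); rewrite addrA subrK.
  have := yN N (leqnn N); have := yN N.+1 (leqnSn N).
  have := sqrt_step_contracts (s_le N) y_le; rewrite (rdistC (s N)).
  rewrite -/(s N.+1); have := rnorm_ge0 (y - s N); lra.
have self_y : y - star y = 0.
  apply: small => e e_gt0; have [|N /(_ N (leqnn N)) yN] := y_lim (2^-1 * e).
    lra.
  have := rnormD (y - s N) (s N - star y); rewrite addrA subrK.
  rewrite -{2}(s_self N) -starB rnorm_star (rdistC (s N)); lra.
(* 1 - y is the root: expand its square and use y + y = h + y * y. *)
exists (1 - y).
  by rewrite starB star1; congr (_ - _); apply/esym/subr0_eq.
have -> : h = y + y - y * y.
  have {1 2}-> := subr0_eq fix_y.
  have half2 : 2^-1 + 2^-1 = 1 :> R by lra.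
  by rewrite -scalerDl -rmorphD half2 scale1r addrK.
by rewrite mulrBl mul1r mulrBr mulr1 -[y + y - _]addrA opprD addrA.
Qed.
End SquareRoot.
End CStarBasics.

(** * The trace inner product and orthonormal families *)

Section Trace.
Context {R : realType} {A : cstarAlgType R} {tr : {linear A -> R[i]^o}}.
Hypothesis htr : is_faithful_tracial_state tr.
Implicit Types x y : A.

Definition inner x y : R[i] := tr (star x * y).
Definition norm2 x : R := complex.Re (inner x x).
Definition sqmod (z : R[i]) : R := complex.Re z ^+ 2 + complex.Im z ^+ 2.

Lemma sqmodE (z : R[i]) : (sqmod z)%:C%C = z * z^*.
Proof. by rewrite -normCK -add_Re2_Im2. Qed.

Lemma sqmod_ge0 (z : R[i]) : 0 <= sqmod z.
Proof. by rewrite addr_ge0 ?sqr_ge0. Qed.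

Lemma sqmodM (z w : R[i]) : sqmod (z * w) = sqmod z * sqmod w.
Proof. by case: z w => [a b] [c d]; rewrite /sqmod /=; lra. Qed.

Lemma trD x y : tr (x + y) = (tr x + tr y :> R[i]).
Proof. exact: raddfD. Qed.

Lemma trZ (a : R[i]) x : tr (a *: x) = (a * tr x :> R[i]).
Proof. exact: linearZ. Qed.

Lemma innerDr z x y : inner z (x + y) = inner z x + inner z y.
Proof. by rewrite /inner mulrDr trD. Qed.

Lemma innerZr z (a : R[i]) x : inner z (a *: x) = a * inner z x.
Proof. by rewrite /inner -scalerAr trZ. Qed.

Lemma innerNr z x : inner z (- x) = - inner z x.
Proof. by rewrite -scaleN1r innerZr mulN1r. Qed.

Lemma innerBr z x y : inner z (x - y) = inner z x - inner z y.
Proof. by rewrite innerDr innerNr. Qed.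

Lemma inner0r z : inner z 0 = 0.
Proof. by rewrite -(scale0r 0) innerZr mul0r. Qed.

Lemma inner_sumr (I : Type) (s : seq I) (F : I -> A) z :
  inner z (\sum_(k <- s) F k) = \sum_(k <- s) inner z (F k).
Proof.
elim: s => [|k s ih]; first by rewrite !big_nil inner0r.
by rewrite !big_cons innerDr ih.
Qed.

Lemma norm2E x : (norm2 x)%:C%C = inner x x.
Proof. by rewrite RRe_real// ger0_real// (state_ge0 htr). Qed.

Lemma norm2_ge0 x : 0 <= norm2 x.
Proof. by rewrite -ler0c norm2E (state_ge0 htr). Qed.

(** A positive functional is hermitian: for every scalar c, the value
    tr ((1 + c x)^* (1 + c x)) is real, so c tr x + conj c tr (star x) is real,
    and c = 1, c = i determine the real and imaginary parts of tr (star x). *)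
Lemma tr_star x : tr (star x) = ((tr x : R[i])^*).
Proof.
have polar (c : R[i]) : complex.Im (c * tr x + c^* * tr (star x)) = 0.
  have := ger0_Im (state_ge0 htr (1 + c *: x)).
  have -> : star (1 + c *: x) * (1 + c *: x) =
      1 + (c *: x + c^* *: star x + (c^* * c) *: (star x * x)).
    rewrite starD star1 starZ mulrDl mul1r mulrDr mulr1 -!addrA.
    by rewrite -scalerAl -scalerAr scalerA.
  rewrite !trD (state1 htr) !trZ -/(inner x x) -norm2E.
  rewrite [_^* * c]mulrC -sqmodE -rmorphM !raddfD /=.
  by rewrite !add0r addr0.
have conj_i : ('i%C : R[i])^* = - 'i%C by rewrite complexiE conjCi.
have := polar 1; have := polar 'i%C; rewrite conj_i rmorph1.
case: (tr x : R[i]) => a b; case: (tr (star x) : R[i]) => c d.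
move=> /= re im; rewrite -[RHS]/(Complex a (- b)); congr Complex; lra.
Qed.

Lemma inner_conj x y : inner y x = (inner x y)^*.
Proof. by rewrite /inner -tr_star starM starK. Qed.

Lemma innerBl z x y : inner (x - y) z = inner x z - inner y z.
Proof. by rewrite !(inner_conj z) innerBr rmorphB. Qed.

Lemma innerZl z (a : R[i]) x : inner (a *: x) z = a^* * inner x z.
Proof. by rewrite !(inner_conj z) innerZr rmorphM. Qed.

Lemma inner_suml (I : Type) (s : seq I) (F : I -> A) z :
  inner (\sum_(k <- s) F k) z = \sum_(k <- s) inner (F k) z.
Proof.
rewrite inner_conj inner_sumr rmorph_sum; apply: eq_bigr => k _.
by rewrite (inner_conj z).
Qed.

(** Automatic continuity of a state, with a constant that is not optimal: for
    c = 1 / (2 |x|^2) the element c x^* x has norm 1/2, so 1 - c x^* x is a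
    square y^* y and its trace is nonnegative. *)
Lemma norm2_le x : norm2 x <= (2 * rnorm x) ^+ 2.
Proof.
have [x0|x_neq0] := eqVneq x 0.
  by rewrite x0 rnorm0 /norm2 inner0r mulr0 expr0n.
have x_gt0 : 0 < rnorm x.
  by rewrite lt_def rnorm_ge0 andbT; apply: contraNneq x_neq0 => /rnorm_eq0/eqP.
have [c c_gt0 hc] : exists2 c : R, 0 < c & c * (2 * rnorm x ^+ 2) = 1.
  have sq_gt0 : 0 < 2 * rnorm x ^+ 2 by rewrite mulr_gt0// exprn_gt0.
  exists (2 * rnorm x ^+ 2)^-1; first by rewrite invr_gt0.
  by rewrite mulVf// gt_eqF.
have [||y y_self hy] := @exists_sqrt_one_sub R A (c%:C%C *: (star x * x)).
- rewrite starZ starM starK; congr (_ *: _).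
  by apply: conj_Creal; apply/complex_realP; exists c.
- by rewrite (rnormZ _ (ltW c_gt0)) rnorm_starM; lra.
have : 0 <= tr (1 - c%:C%C *: (star x * x)) :> R[i].
  by rewrite hy -{1}y_self (state_ge0 htr).
rewrite -scaleNr trD trZ (state1 htr) -/(inner x x) -norm2E -rmorphN -rmorphM.
rewrite -[1 : R[i]](rmorph1 (real_complex R)) -rmorphD ler0c => tr_ge0.
rewrite -(ler_pM2l c_gt0); nra.
Qed.

Section Orthonormal.
Context {I : eqType} {W : I -> A}.
Hypothesis W_ortho : forall k l, inner (W k) (W l) = (k == l)%:R.

Definition partial_sum (s : seq I) x := \sum_(k <- s) inner (W k) x *: W k.

Lemma inner_partial_sum (s : seq I) x l : uniq s -> l \in s ->
  inner (W l) (partial_sum s x) = inner (W l) x.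
Proof.
move=> s_uniq ls; rewrite inner_sumr (bigD1_seq l)//= big1 ?addr0.
  by rewrite innerZr W_ortho eqxx mulr1.
by move=> k kl; rewrite innerZr W_ortho eq_sym (negPf kl) mulr0.
Qed.

(** Pythagoras: the remainder x - P x is orthogonal to each W k with k in s,
    hence to P x. *)
Lemma bessel_eq (s : seq I) x : uniq s ->
  norm2 (x - partial_sum s x) = norm2 x - \sum_(k <- s) sqmod (inner (W k) x).
Proof.
move=> s_uniq; apply: complexI; rewrite norm2E rmorphB rmorph_sum /= norm2E.
rewrite innerBl [X in _ - X](_ : _ = 0) ?subr0; last first.
  rewrite inner_suml big1_seq// => k /= ks.
  by rewrite innerZl innerBr inner_partial_sum// subrr mulr0.
rewrite innerBr inner_sumr; congr (_ - _); apply: eq_bigr => k _.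
by rewrite innerZr sqmodE -inner_conj.
Qed.

Lemma bessel (s : seq I) x : uniq s ->
  \sum_(k <- s) sqmod (inner (W k) x) <= norm2 x.
Proof. by move=> s_uniq; rewrite -subr_ge0 -bessel_eq// norm2_ge0. Qed.

Lemma sqmod_inner_le k x : sqmod (inner (W k) x) <= (2 * rnorm x) ^+ 2.
Proof.
apply: le_trans (norm2_le x); have := @bessel [:: k] x isT.
by rewrite big_seq1.
Qed.

(** The linear span of the family, built one term at a time so that closure
    properties follow by induction without handling finite sums. *)
Inductive spanned : A -> Prop :=
| spanned0 : spanned 0
| spannedS c k x : spanned x -> spanned (c *: W k + x).

Lemma spannedD x y : spanned x -> spanned y -> spanned (x + y).
Proof.
move=> px py; elim: px => [|c k {}x _ ih]; first by rewrite add0r.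
by rewrite -addrA; apply: spannedS.
Qed.

Lemma spannedZ a x : spanned x -> spanned (a *: x).
Proof.
elim=> [|c k {}x _ ih]; first by rewrite scaler0; exact: spanned0.
by rewrite scalerDr scalerA; apply: spannedS.
Qed.

Lemma spanned_gen k : spanned (W k).
Proof.
by rewrite -[W k]addr0 -[W k]scale1r; apply: spannedS; exact: spanned0.
Qed.

Lemma partial_sumD s x y :
  partial_sum s (x + y) = partial_sum s x + partial_sum s y.
Proof.
by rewrite -big_split; apply: eq_bigr => k _; rewrite innerDr scalerDl.
Qed.

Lemma partial_sumZ s a x : partial_sum s (a *: x) = a *: partial_sum s x.
Proof.
by rewrite scaler_sumr; apply: eq_bigr => k _; rewrite innerZr scalerA.
Qed.

Lemma partial_sumB s x y :
  partial_sum s (x - y) = partial_sum s x - partial_sum s y.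
Proof. by rewrite -scaleN1r partial_sumD partial_sumZ scaleN1r. Qed.

(** Quantifying over all larger sets of indices makes the induction go through:
    a combination lies in the span of every set that contains its indices. *)
Lemma spanned_support x : spanned x ->
  exists s0 : seq I,
    forall s, uniq s -> {subset s0 <= s} -> partial_sum s x = x.
Proof.
elim=> [|c k {}x _ [s0 ih]].
  by exists [::] => s _ _; rewrite -[in LHS](scale0r 0) partial_sumZ scale0r.
exists (k :: s0) => s s_uniq sub_s.
rewrite partial_sumD partial_sumZ ih//; last first.
  by move=> l ls; apply: sub_s; rewrite inE ls orbT.
congr (_ *: _ + _); rewrite /partial_sum (bigD1_seq k)//=; last first.
  by apply: sub_s; rewrite mem_head.
rewrite W_ortho eqxx scale1r big1 ?addr0// => l lk.
by rewrite W_ortho (negPf lk) scale0r.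
Qed.

Lemma spanned_partial_sum x : spanned x ->
  exists2 s, uniq s & partial_sum s x = x.
Proof.
move=> /spanned_support[s0 s0P].
exists (undup s0); first exact: undup_uniq.
by apply: s0P (undup_uniq s0) _ => k; rewrite mem_undup.
Qed.

(** Parseval's equality up to e.  If p is a combination of the W k with k in s,
    then x and x - p have the same remainder after projection on s, and this
    remainder is no larger than x - p. *)
Lemma parseval_approx x :
  (forall e, 0 < e -> exists2 p, spanned p & rnorm (x - p) < e) ->
  forall e, 0 < e ->
  exists2 s, uniq s & norm2 x <= \sum_(k <- s) sqmod (inner (W k) x) + e.
Proof.
move=> x_closure e e_gt0.
(* With |x - p| < r this gives (2 |x - p|)^2 <= 4 r <= e. *)
pose r := Num.min 1 (e / 4).
have r_gt0 : 0 < r by rewrite lt_min ltr01 divr_gt0.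
have [p /spanned_partial_sum[s s_uniq ps] xp] := x_closure r r_gt0.
exists s => //; rewrite -lerBlDl -bessel_eq//.
have -> : x - partial_sum s x = x - p - partial_sum s (x - p).
  by rewrite partial_sumB ps opprB addrA subrK.
rewrite bessel_eq//.
have : 0 <= \sum_(k <- s) sqmod (inner (W k) (x - p)).
  by apply: sumr_ge0 => k _; exact: sqmod_ge0.
have := norm2_le (x - p); have := rnorm_ge0 (x - p).
have : r <= 1 by rewrite ge_min lexx.
have : r <= e / 4 by rewrite ge_min lexx orbT.
set a := rnorm _ in xp *.
move=> r1 r2 a_ge0 le_a S_ge0.
have : a * a <= r * 1 by apply: ler_pM => //; lra.
rewrite expr2 in le_a; lra.
Qed.

End Orthonormal.
End Trace.

(* Unitary elements of a C*-algebra, not isometries of a sesquilinear form. *)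
Local Notation is_unitary := Defs.is_unitary.

(** * Integer powers of unitaries and quasi-commutation *)

Section Rotation.
Context {R : realType} {A : cstarAlgType R}.
Implicit Types x y u v : A.

Lemma zpow1Dl u (m : int) : is_unitary u -> zpow u (1 + m) = u * zpow u m.
Proof.
move=> [_ us]; case: m => [n|[|n]]; first by rewrite -[RHS]exprS.
  by rewrite /= expr1 us.
have -> : 1 + Negz n.+1 = Negz n.
  by rewrite !NegzE [in X in 1 - X]intS opprD addNKr.
by rewrite [RHS]/= [in RHS]exprS mulrA us mul1r.
Qed.

Lemma zpowN1Dl u (m : int) :
  is_unitary u -> zpow u (- 1 + m) = star u * zpow u m.
Proof.
move=> uU; rewrite -[m in RHS](addKr (- 1)) opprK zpow1Dl// mulrA.
by case: uU => -> _; rewrite mul1r.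
Qed.

Lemma zpowD u (m n : int) : is_unitary u ->
  zpow u (m + n) = zpow u m * zpow u n.
Proof.
move=> uU; elim/int_rect: m => [|m ih|m ih].
- by rewrite add0r mul1r.
- by rewrite intS -addrA !zpow1Dl// ih mulrA.
- by rewrite intS opprD -addrA !zpowN1Dl// ih mulrA.
Qed.

Lemma star_zpow u (m : int) : is_unitary u -> star (zpow u m) = zpow u (- m).
Proof.
move=> uU; have uUm : zpow u m * zpow u (- m) = 1.
  by rewrite -zpowD// subrr.
suff um : star (zpow u m) * zpow u m = 1.
  by rewrite -[LHS]mulr1 -uUm mulrA um mul1r.
case: uU => su us; case: m {uUm} => n /=.
  elim: n => [|n ih]; first by rewrite !expr0 star1 mul1r.
  by rewrite exprS starM -!mulrA (mulrA (star u)) su mul1r.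
move: n.+1 => {}n; elim: n => [|n ih]; first by rewrite !expr0 star1 mul1r.
by rewrite exprS starM starK -!mulrA (mulrA u) us mul1r.
Qed.

(** The scalar is left unspecified: only the fact that monomials can be
    reordered up to a factor matters. *)
Definition qcommute x y := exists c : R[i], x * y = c *: (y * x).

Lemma qcommute_zpow x u (m : int) :
  qcommute x u -> qcommute x (star u) -> qcommute x (zpow u m).
Proof.
have pow v n : qcommute x v -> qcommute x (v ^+ n).
  move=> [c xv]; elim: n => [|n [d xvn]].
    by exists 1; rewrite expr0 mulr1 mul1r scale1r.
  exists (c * d); rewrite exprS mulrA xv -scalerAl -[v * x * _]mulrA xvn.
  by rewrite -scalerAr scalerA mulrA.
by case: m => n xu xsu; apply: pow.
Qed.

(** Multiply x u = c u x by star u on both sides. *)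
Lemma qcommute_star x u : is_unitary u -> qcommute x u -> qcommute (star u) x.
Proof.
move=> [su us] [c xu]; exists c.
rewrite -[LHS]mulr1 -us !mulrA -(mulrA (star u)) xu.
by rewrite -scalerAr mulrA su mul1r -scalerAl.
Qed.

(** * Eigenvectors of a derivation *)

Section Derivation.
Context {d : unbounded_op A}.
Hypothesis hd : is_star_derivation d.

Definition eigenvector (c : R[i]) x := dom d x /\ d x = c *: x.

Lemma eigenvectorM a b x y :
  eigenvector a x -> eigenvector b y -> eigenvector (a + b) (x * y).
Proof.
move=> [xd dx] [yd dy]; split.
  exact: (star_subalgebraM (derivation_dom hd)).
by rewrite (derivationM hd)// dx dy -scalerAl -scalerAr scalerDl.
Qed.

Lemma eigenvector1 : eigenvector 0 1.
Proof.
have d1 := star_subalgebra1 (derivation_dom hd); split => //.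
rewrite scale0r; apply: (addrI (d 1)); rewrite addr0.
by have := derivationM hd d1 d1; rewrite !mulr1 mul1r => <-.
Qed.

(** Differentiate star u * u = 1. *)
Lemma eigenvector_star a u : is_unitary u ->
  eigenvector a u -> eigenvector (- a) (star u).
Proof.
move=> [su us] [ud du].
have sud := star_subalgebra_star (derivation_dom hd) ud.
split => //; have [_] := eigenvector1; rewrite -su (derivationM hd)// du.
rewrite scale0r -scalerAr => /(congr1 (fun z => z * star u)).
rewrite mul0r mulrDl -mulrA us mulr1 -scalerAl su mul1r scaleNr.
by move/eqP; rewrite addr_eq0 => /eqP.
Qed.

Lemma eigenvector_zpow a u (m : int) : is_unitary u ->
  eigenvector a u -> eigenvector (m%:~R * a) (zpow u m).
Proof.
move=> uU ua; have ua' := eigenvector_star uU ua.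
elim/int_rect: m => [|m ih|m ih].
- by rewrite mul0r; exact: eigenvector1.
- by rewrite intS rmorphD mulrDl mul1r zpow1Dl//; exact: eigenvectorM.
- by rewrite intS opprD rmorphD mulrDl mulN1r zpowN1Dl//; exact: eigenvectorM.
Qed.

End Derivation.

(** * Monomials and trigonometric polynomials *)

Context {theta : R} {U V : A} {tr : {linear A -> R[i]^o}}.
Hypothesis hUV : rotation_relation theta U V.
Hypothesis htr : is_canonical_trace U V tr.

Local Notation inner := (@inner R A tr).
Local Notation norm2 := (@norm2 R A tr).

Let UU : is_unitary U. Proof. by case: hUV. Qed.
Let VU : is_unitary V. Proof. by case: hUV. Qed.

Definition monomial (k : int * int) : A := zpow U k.1 * zpow V k.2.

(** By the trace property, tr (V^-n U^-m U^p V^q) = tr (U^(p-m) V^(q-n)). *)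
Lemma monomial_ortho k l : inner (monomial k) (monomial l) = (k == l)%:R.
Proof.
case: k l => [m n] [p q]; rewrite /inner /monomial starM !star_zpow//=.
have -> : zpow V (- n) * zpow U (- m) * (zpow U p * zpow V q) =
    zpow V (- n) * (zpow U (p - m) * zpow V q).
  by rewrite [p - m]addrC zpowD// !mulrA.
rewrite (trace_comm htr.1) -mulrA -zpowD// htr.2 !subr_eq0.
by rewrite [p == m]eq_sym [q == n]eq_sym.
Qed.

Lemma expi_conj (t : R) : expi t * (expi t)^* = 1.
Proof. by rewrite -sqmodE /sqmod /= cos2Dsin2. Qed.

Lemma expi_neq0 (t : R) : expi t != 0.
Proof.
apply/eqP => t0; have := expi_conj t; rewrite t0 mul0r => /eqP.
by rewrite eq_sym oner_eq0.
Qed.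

Lemma qcommute_sym x y (c : R[i]) :
  c != 0 -> x * y = c *: (y * x) -> qcommute y x.
Proof.
by move=> c_neq0 xy; exists c^-1; rewrite xy scalerA mulVf// scale1r.
Qed.

Local Notation trig_poly := (@spanned R A _ monomial).

Lemma generator_monomial g k : g \in [:: U; star U; V; star V] ->
  exists c l, g * monomial k = c *: monomial l.
Proof.
have vu : qcommute V U.
  by case: hUV => _ _ /qcommute_sym; apply; exact: expi_neq0.
have svu : qcommute (star V) U.
  apply: qcommute_star => //.
  by case: hUV => _ _ ?; exists (expi (2 * pi * theta)).
have vsu : qcommute V (star U).
  rewrite -(starK V); apply: qcommute_star; last exact: qcommute_star.
  by split; rewrite starK; case: VU.
have svsu : qcommute (star V) (star U).
  by apply: qcommute_star => //; exact: qcommute_star.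
(* U and star U shift the first exponent; V and star V have to cross the power
   of U before they shift the second one. *)
rewrite !inE => /or4P[] /eqP->.
- by exists 1, (1 + k.1, k.2); rewrite scale1r /monomial zpow1Dl// mulrA.
- by exists 1, (- 1 + k.1, k.2); rewrite scale1r /monomial zpowN1Dl// mulrA.
- have [c cE] := qcommute_zpow k.1 vu vsu; exists c, (k.1, 1 + k.2).
  by rewrite /monomial zpow1Dl// mulrA cE -scalerAl mulrA.
- have [c cE] := qcommute_zpow k.1 svu svsu; exists c, (k.1, - 1 + k.2).
  by rewrite /monomial zpowN1Dl// mulrA cE -scalerAl mulrA.
Qed.

Lemma trig_poly_generator g x : g \in [:: U; star U; V; star V] ->
  trig_poly x -> trig_poly (g * x).
Proof.
move=> gUV; elim=> [|c k {}x _ ih]; first by rewrite mulr0; exact: spanned0.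
have [a [l gk]] := generator_monomial k gUV.
by rewrite mulrDr -scalerAr gk scalerA; apply: spannedS.
Qed.

(** The elements z such that z and star z both multiply the trigonometric
    polynomials into themselves form a *-subalgebra.  It contains U and V, hence
    every x of the generated *-algebra, and x = x * 1. *)
Lemma star_generated_trig_poly x :
  star_generated [set U; V]%classic x -> trig_poly x.
Proof.
pose multiplier z := (forall y, trig_poly y -> trig_poly (z * y)) /\
                     (forall y, trig_poly y -> trig_poly (star z * y)).
move=> xUV; suff [x_mul _] : multiplier x.
  rewrite -[x]mulr1; apply: x_mul.
  have := spanned_gen (W := monomial) (0, 0).
  by rewrite /monomial /= !expr0 mulr1.
apply: (xUV multiplier); split.
  split.
  - by split=> y; rewrite ?star1 mul1r.
  - move=> y z [y1 y2] [z1 z2]; split=> t tt; rewrite ?starD mulrDl.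
      by apply: spannedD; [exact: y1|exact: z1].
    by apply: spannedD; [exact: y2|exact: z2].
  - move=> a y [y1 y2]; split=> t tt; rewrite ?starZ -scalerAl.
      by apply: spannedZ; exact: y1.
    by apply: spannedZ; exact: y2.
  - move=> y z [y1 y2] [z1 z2]; split=> t tt; rewrite ?starM -mulrA.
      by apply/y1/z1.
    by apply/z2/y2.
  - by move=> y [y1 y2]; split=> // t tt; rewrite starK; exact: y1.
by move=> _ [->|->]; split=> t; apply: trig_poly_generator;
  rewrite !inE eqxx ?orbT.
Qed.

(** * Fourier coefficients of a canonical derivation *)

(** The two derivations are treated at once, as the one with U and V
    eigenvectors for arbitrary eigenvalues a and b. *)
Section CanonicalDerivation.
Context {a b : R[i]} {d : unbounded_op A}.
Hypothesis hd : is_canonical_derivation U V (a *: U) (b *: V) d.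

Definition weight (k : int * int) : R[i] := k.1%:~R * a + k.2%:~R * b.

Let dstar : is_star_derivation d. Proof. by case: hd. Qed.

Lemma eigenvector_monomial k : @eigenvector d (weight k) (monomial k).
Proof.
case: hd => _ [Ud Vd] [dU dV] _.
by apply: eigenvectorM => //; apply: eigenvector_zpow.
Qed.

Lemma trig_poly_derivation p : trig_poly p ->
  dom d p /\
  forall k, inner (monomial k) (d p) = weight k * inner (monomial k) p.
Proof.
have [dom0 _] := eigenvector1 dstar.
elim=> [|c l {}p _ [pd ih]].
  have d0 : dom d 0.
    by rewrite -(scale0r 1); exact: (star_subalgebraZ (derivation_dom dstar)).
  split=> // k; rewrite -{1}(scale0r 0) (derivationZ dstar)// scale0r.
  by rewrite inner0r mulr0.
have [ld dl] := eigenvector_monomial l.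
have cld := star_subalgebraZ (derivation_dom dstar) c ld.
split; first exact: (star_subalgebraD (derivation_dom dstar)).
move=> k; rewrite (derivationD dstar)// (derivationZ dstar)// dl.
rewrite !innerDr ih !innerZr monomial_ortho mulrDr; congr (_ + _).
by have [->|_] := eqVneq k l; rewrite ?mulr0// mulr1 mulrC mulr1.
Qed.

Lemma trig_poly_core x e : dom d x -> 0 < e ->
  exists p, [/\ trig_poly p, rnorm (x - p) < e & rnorm (d x - d p) < e].
Proof.
move=> xd e_gt0; case: hd => _ _ _ graphE.
have : graph d (x, d x) by [].
rewrite graphE => /(closure_prod_approx e_gt0)[w [[[wd ws] w2] lt1 lt2]].
by exists w.1; split=> //; [exact: star_generated_trig_poly|rewrite -[d w.1]w2].
Qed.

(** Both sides are continuous for the graph norm, and they agree on the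
    trigonometric polynomials, whose graph is dense in that of d. *)
Lemma fourier_derivation x k : dom d x ->
  inner (monomial k) (d x) = weight k * inner (monomial k) x.
Proof.
move=> xd; apply/eqP; rewrite -subr_eq0; set z := (X in X == 0).
have z_le e : 0 < e -> sqmod z <= 8 * (1 + sqmod (weight k)) * e ^+ 2.
  move=> e_gt0; have [p [pt xp dxp]] := trig_poly_core xd e_gt0.
  have [_ dp] := trig_poly_derivation pt.
  have -> : z = inner (monomial k) (d x - d p) -
      weight k * inner (monomial k) (x - p).
    by rewrite !innerBr dp mulrBr opprB addrA subrK.
  have sqmodB (v w : R[i]) : sqmod (v - w) <= 2 * sqmod v + 2 * sqmod w.
    case: v w => [v1 v2] [w1 w2]; rewrite /sqmod /=.
    by have := sqr_ge0 (v1 + w1); have := sqr_ge0 (v2 + w2); lra.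
  apply: (le_trans (sqmodB _ _)); rewrite sqmodM.
  have := sqmod_inner_le htr.1 monomial_ortho k (d x - d p).
  have := sqmod_inner_le htr.1 monomial_ortho k (x - p).
  have : rnorm (x - p) ^+ 2 <= e ^+ 2.
    by rewrite ler_sqr ?nnegrE ?rnorm_ge0 ?ltW.
  have : rnorm (d x - d p) ^+ 2 <= e ^+ 2.
    by rewrite ler_sqr ?nnegrE ?rnorm_ge0 ?ltW.
  rewrite !exprMn => h1 h2 h3 h4.
  have : sqmod (weight k) * sqmod (inner (monomial k) (x - p)) <=
      sqmod (weight k) * (2 ^+ 2 * e ^+ 2).
    apply: ler_wpM2l; first exact: sqmod_ge0.
    by apply: (le_trans h3); rewrite ler_wpM2l.
  lra.
have sqmodz : sqmod z = 0.
  apply/eqP; rewrite eq_le sqmod_ge0 andbT; apply/ler_addgt0Pr => t t_gt0.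
  rewrite add0r; set M := 8 * (1 + sqmod (weight k)).
  have M_gt0 : 0 < M by rewrite /M; have := sqmod_ge0 (weight k); lra.
  (* e <= 1 gives M * e ^+ 2 <= M * e <= t. *)
  pose e := Num.min 1 (t / M).
  have e_gt0 : 0 < e by rewrite lt_min ltr01 divr_gt0.
  apply: (le_trans (z_le e e_gt0)); rewrite -/M -ler_pdivlMl// mulrC.
  have e_le1 : e <= 1 by rewrite ge_min lexx.
  have e_le : e <= t / M by rewrite ge_min lexx orbT.
  by apply: le_trans e_le; rewrite expr2 ler_piMr// ltW.
by rewrite -normr_eq0 -sqrf_eq0 -add_Re2_Im2 -/(sqmod z) sqmodz.
Qed.
End CanonicalDerivation.

End Rotation.

(** * The Poincare inequality and the energy bound *)

Section Poincare.
Context {R : realType} {A : cstarAlgType R}.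
Context {theta : R} {U V : A} {tr : {linear A -> R[i]^o}}.
Hypothesis hUV : rotation_relation theta U V.
Hypothesis htr : is_canonical_trace U V tr.

Local Notation inner := (@inner R A tr).
Local Notation norm2 := (@norm2 R A tr).
Local Notation monomial := (@monomial R A U V).

(** The real part of exp (2 pi i t) is 1 - 2 sin^2 (pi t), and 0 < pi t < pi. *)
Lemma expi_neq1 (t : R) : 0 < t < 1 -> expi (2 * pi * t) != 1.
Proof.
move=> /andP[t_gt0 t_lt1]; apply/eqP => /(congr1 (@complex.Re R)) /=.
have s_gt0 : 0 < sin (pi * t).
  by apply: sin_gt0_pi; rewrite mulr_gt0 ?pi_gt0//= gtr_pMr ?pi_gt0.
have -> : 2 * pi * t = pi * t *+ 2 by rewrite mulr2n; lra.
have := cos2Dsin2 (pi * t); rewrite mulr2n cosD.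
have : 0 < sin (pi * t) * sin (pi * t) by rewrite mulr_gt0.
rewrite !expr2; lra.
Qed.

(** u = u v v^* = c v u v^*, and v u v^* has the same trace as u. *)
Lemma tr_qcommute_eq0 (c : R[i]) (u v : A) : is_unitary v -> c != 1 ->
  u * v = c *: (v * u) -> tr u = 0 :> R[i].
Proof.
move=> [vv' v'v] c_neq1 uv.
have tr_u : tr u = c * tr u :> R[i].
  rewrite -trZ -[LHS]/(tr u) -[u in LHS]mulr1 -v'v mulrA uv -scalerAl !trZ.
  by rewrite -mulrA (trace_comm htr.1) -mulrA vv' mulr1.
apply/eqP; have /eqP := tr_u; rewrite -subr_eq0 -[X in X - _]mul1r -mulrBl.
by rewrite mulf_eq0 subr_eq0 eq_sym (negPf c_neq1).
Qed.

Context {delta1 delta2 : unbounded_op A}.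
Hypothesis hdelta1 : is_delta1 U V delta1.
Hypothesis hdelta2 : is_delta2 U V delta2.

Let canonical1 : is_canonical_derivation U V (twopii *: U) (0 *: V) delta1.
Proof. by rewrite scale0r. Qed.

Let canonical2 : is_canonical_derivation U V (0 *: U) (twopii *: V) delta2.
Proof. by rewrite scale0r. Qed.

Lemma fourier_delta1 x k : dom delta1 x ->
  inner (monomial k) (delta1 x) = k.1%:~R * twopii * inner (monomial k) x.
Proof.
move=> xd; rewrite (fourier_derivation hUV htr canonical1)//.
by rewrite /weight mulr0 addr0.
Qed.

Lemma fourier_delta2 x k : dom delta2 x ->
  inner (monomial k) (delta2 x) = k.2%:~R * twopii * inner (monomial k) x.
Proof.
move=> xd; rewrite (fourier_derivation hUV htr canonical2)//.
by rewrite /weight mulr0 add0r.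
Qed.

Lemma sqmod_twopii (m : int) :
  sqmod (m%:~R * twopii : R[i]) = (2 * pi) ^+ 2 * (m ^+ 2)%:~R.
Proof.
rewrite sqmodM rmorphXn [RHS]mulrC; congr (_ * _).
  by rewrite -(rmorph_int (real_complex R)) /sqmod /= expr0n addr0.
by rewrite /sqmod /= expr0n add0r.
Qed.

(** Every frequency (m, n) other than (0, 0) has m^2 + n^2 >= 1, and the
    coefficient at (0, 0) is tr x = 0; this holds for each finite set of
    frequencies, and finite sets suffice to recover tr (x^* x). *)
Lemma poincare x : dom delta1 x -> dom delta2 x -> tr x = 0 :> R[i] ->
  (2 * pi) ^+ 2 * norm2 x <= norm2 (delta1 x) + norm2 (delta2 x).
Proof.
move=> xd1 xd2 trx0; set E := _ + _.
have pi2_gt0 : (0 : R) < (2 * pi) ^+ 2 by rewrite exprn_gt0// mulr_gt0// pi_gt0.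
have ortho := monomial_ortho hUV htr.
have sum_le s : uniq s ->
    (2 * pi) ^+ 2 * (\sum_(k <- s) sqmod (inner (monomial k) x)) <= E.
  move=> s_uniq.
  have := bessel htr.1 ortho (delta1 x) s_uniq.
  have := bessel htr.1 ortho (delta2 x) s_uniq.
  move=> le2 le1; apply: le_trans (lerD le1 le2).
  rewrite -big_split mulr_sumr; apply: ler_sum => -[m n] _ /=.
  rewrite fourier_delta1// fourier_delta2// [X in _ <= X + _]sqmodM.
  rewrite [X in _ <= _ + X]sqmodM !sqmod_twopii /= -mulrDl -mulrDr -rmorphD /=.
  rewrite -mulrA; apply: ler_wpM2l; first exact: ltW.
  have [-> /=|mn_neq0] := eqVneq (m, n) (0, 0).
    rewrite /inner /monomial /= !expr0 mulr1 star1 mul1r trx0.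
    by rewrite /sqmod /= expr0n addr0 !mulr0.
  rewrite ler_peMl ?sqmod_ge0// ler1z.
  rewrite -gtz0_ge1 lt_def paddr_eq0 ?sqr_ge0// !sqrf_eq0 addr_ge0 ?sqr_ge0//.
  by rewrite andbT; apply: contraNN mn_neq0 => /andP[/eqP-> /eqP->].
rewrite mulrC -ler_pdivlMr//; apply/ler_addgt0Pr => e e_gt0.
have [e' e'_gt0|s s_uniq le_s] := parseval_approx htr.1 ortho (x := x) _ e_gt0.
  have [p [pt xp _]] := trig_poly_core hUV canonical1 xd1 e'_gt0.
  by exists p.
by apply: le_trans le_s _; rewrite lerD2r ler_pdivlMr// mulrC sum_le.
Qed.

Lemma energy_ge (u : A) : is_unitary u -> tr u = 0 :> R[i] ->
  ((2 * pi ^+ 2)%:E <= energy tr delta1 delta2 u)%E.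
Proof.
move=> [su _] tru0; rewrite /energy; case: asboolP => [[ud1 ud2]|_]; last first.
  exact: leey.
rewrite lee_fin trD raddfD /=.
have := poincare ud1 ud2 tru0.
rewrite {1}/norm2 /inner su (state1 htr.1) /= -/(inner _ _) -/(norm2 _).
rewrite -/(inner _ (delta2 u)) -/(norm2 _).
lra.
Qed.
End Poincare.

Theorem theorem3 (R : realType) (theta : R) (htheta : 0 < theta < 1)
    (A : cstarAlgType R) (U V : A) (hA : is_rotation_algebra theta U V)
    (tr : {linear A -> R[i]^o}) (htr : is_canonical_trace U V tr)
    (delta1 delta2 : unbounded_op A)
    (hdelta1 : is_delta1 U V delta1) (hdelta2 : is_delta2 U V delta2)
    (phi : {lrmorphism A -> A}) (hphi : star_preserving phi) :
  ((4 * (3 - Num.sqrt 5) * pi ^+ 2)%:E <=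
     endo_energy tr delta1 delta2 U V phi)%E.
Proof.
have [[UU VU UV] _] := hA.
have phi_unitary u : is_unitary u -> is_unitary (phi u).
  by move=> [su us]; split; rewrite -hphi -rmorphM (su, us) rmorph1.
have phi_UV : phi U * phi V = expi (2 * pi * theta) *: (phi V * phi U).
  by have := congr1 phi UV; rewrite linearZ /= !rmorphM.
have lambda_neq1 := expi_neq1 htheta.
have lambda_neq0 := expi_neq0 (2 * pi * theta).
have phi_VU : phi V * phi U = (expi (2 * pi * theta))^-1 *: (phi U * phi V).
  by rewrite phi_UV scalerA mulVf// scale1r.
have energy_ge2 := energy_ge hA.1 htr hdelta1 hdelta2.
have eU := energy_ge2 _ (phi_unitary _ UU)
  (tr_qcommute_eq0 htr (phi_unitary _ VU) lambda_neq1 phi_UV).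
have lambdaV_neq1 : (expi (2 * pi * theta))^-1 != 1 by rewrite invr_eq1.
have eV := energy_ge2 _ (phi_unitary _ VU)
  (tr_qcommute_eq0 htr (phi_unitary _ UU) lambdaV_neq1 phi_VU).
have le2 (x : \bar R) : ((2 * pi ^+ 2)%:E <= x ->
    (4 * pi ^+ 2)%:E <= 2%:E * x)%E.
  case: x => [r|_|//]; first by rewrite -EFinM !lee_fin; lra.
  by rewrite gt0_muley ?leey// lte_fin.
apply: le_trans (leeD (le2 _ eU) (le2 _ eV)).
rewrite -EFinD lee_fin.
have sqrt5 : 1 <= Num.sqrt 5 :> R by rewrite -[leLHS]sqrtr1 ler_sqrt; lra.
have pi2 : 0 <= (pi : R) ^+ 2 by rewrite sqr_ge0.
have := ler_wpM2r pi2 sqrt5; lra.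
Qed.
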